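(* Let $F$ and $L$ be subfields of a field $K$, put $F_0=F\cap L$, and assume that $K/F$ is a cyclic Galois extension of degree $n$ with $\mathrm{Gal}(K/F)=\langle\sigma\rangle$, that $K/L$ is a cyclic Galois extension of degree $m$ with $\mathrm{Gal}(K/L)=\langle\tau\rangle$, and that $\sigma\tau=\tau\sigma$. Let $D=(K/F,\sigma,c)$ be an associative cyclic division algebra over $F$ of degree $n$ with $c\in F_0^\times$, and let $d\in D^\times$. Let $R=D[t;\widetilde{\tau}^{-1}]$ and $f(t)=t^m-d\in R$. Then $$\mathrm{It}_R^m(D,\tau,d)=S_f ,$$ i.e. identifying $u^i x$ with $t^i x$ ($x\in D$, $0\le i<m$) identifies the two algebras.
   Context: Algebras are unital but not necessarily associative. Cyclic algebra: for $c\in F^\times$, $(K/F,\sigma,c)=K\oplus eK\oplus\dots\oplus e^{n-1}K$ is the associative $F$-algebra with $e^n=c$ and $le=e\sigma(l)$ for all $l\in K$. The map $\widetilde\tau$: for $x=x_0+ex_1+\dots+e^{n-1}x_{n-1}\in D$ with $x_i\in K$, $\widetilde\tau(x)=\tau(x_0)+e\tau(x_1)+\dots+e^{n-1}\tau(x_{n-1})$. Since $c\in F_0$, $\widetilde\tau$ is a ring automorphism of $D$. Iterated algebra $\mathrm{It}_R^m(D,\tau,d)$: the right $D$-module $D\oplus uD\oplus u^2D\oplus\dots\oplus u^{m-1}D$ (free of rank $m$, with formal symbols $u^i$), with the biadditive multiplication given by $(u^ix)(u^jy)=u^{i+j}\widetilde\tau^{j}(x)y$ if $i+j<m$, and $(u^ix)(u^jy)=u^{(i+j)-m}\widetilde\tau^{j}(x)yd$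 if $i+j\ge m$, for $x,y\in D$, $0\le i,j<m$. (The subscript $R$ in $\mathrm{It}_R^m$ is only part of the notation.) It is an algebra over $F_0$. Twisted polynomial ring: for a ring automorphism $\rho$ of $D$, $D[t;\rho]$ is the ring of polynomials $\sum a_it^i$, $a_i\in D$, with term-wise addition and multiplication determined by $ta=\rho(a)t$ for $a\in D$. The algebra $S_f$: for $f\in D[t;\rho]$ of degree $m$, whose leading coefficient is invertible, every $g$ can be written uniquely as $g=qf+r$ with $\deg r<m$; $r$ is the remainder of right division by $f$, written $g\ \mathrm{mod}_r f$. $S_f$ is the set $\{g\in D[t;\rho]\mid \deg g<m\}$ with the usual addition and the multiplication $g\circ h=gh\ \mathrm{mod}_r f$. *)

(* Defs.v *)
From HB Require Import structures.
From mathcomp Require Import all_boot all_order all_fingroup all_algebra.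
From mathcomp Require Import all_solvable all_field.
From mathcomp Require Import boolp classical_sets.

Set Implicit Arguments.
Unset Strict Implicit.
Unset Printing Implicit Defensive.

Import GRing.Theory.
Local Open Scope ring_scope.

Definition invertible (R : nzRingType) (x : R) : Prop :=
  exists y : R, y * x = 1 /\ x * y = 1.

Definition division_ring (R : nzRingType) : Prop :=
  forall x : R, x != 0 -> invertible x.

(* K/F is Galois of degree n with cyclic group generated by s.  [galois] and
   ['Gal] live in splitting fields over a base field, whereas F and L below are
   two subfields of the same K, with no common base field given; hence K/F is
   presented as an isomorphic copy of an extension E of a field k. *)
Definition cyclic_galois (K : fieldType) (F : divringClosed K) (n : nat)
    (s : {rmorphism K -> K}) : Prop :=
  exists (k : fieldType) (E : splittingFieldType k) (phi : {rmorphism E -> K})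
      (g : gal_of {:E}),
    [/\ bijective phi, forall x : E, (phi x \in F) = (x \in 1%VS),
        galois 1 {:E} /\ \dim {:E} = n,
        'Gal({:E} / 1)%g = <[g]>%g
      & forall x : E, s (phi x) = phi (g x)].

Section CyclicGalois.
Variables (K : fieldType) (F : divringClosed K) (n : nat).
Variables (s : {rmorphism K -> K}) (hF : cyclic_galois F n s).

Lemma cyclic_galois_gt0 : (0 < n)%N.
Proof.
have [k [E [_ [_ [_ _ [_ <-] _ _]]]]] := hF.
by rewrite lt0n; apply/eqP => E0; have := dimvS (sub1v {:E}); rewrite E0 dimv1.
Qed.

Lemma cyclic_galois_iter x : iter n s x = x.
Proof.
have [k [E [phi [g [bphi _ [gal dimE] genE sE]]]]] := hF.
have [psi phiK psiK] := bphi; rewrite -[x]psiK.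
have -> : iter n s (phi (psi x)) = phi ((g ^+ n)%g (psi x)).
  elim: n => [|j IHj]; first by rewrite expg0 gal_id.
  by rewrite iterS IHj sE expgSr galM ?memvf.
suff -> : (g ^+ n)%g = 1%g by rewrite gal_id.
by rewrite -dimE; have := galois_dim gal; rewrite dimv1 divn1 => ->;
  rewrite genE -orderE expg_order.
Qed.

Lemma cyclic_galois_fix x : x \in F -> s x = x.
Proof.
have [k [E [phi [g [[psi phiK psiK] phiF _ genE sE]]]]] := hF.
rewrite -[x]psiK phiF sE => x1; congr (phi _).
by apply: fixed_gal x1; rewrite ?sub1v // genE cycle_id.
Qed.

Lemma cyclic_galois_bij : bijective s.
Proof.
exists (iter n.-1 s) => x; have := cyclic_galois_iter x.
  by rewrite -{1}(prednK cyclic_galois_gt0) iterSr.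
by rewrite -{1}(prednK cyclic_galois_gt0) iterS.
Qed.

End CyclicGalois.

(* An element v of {ffun 'I_m -> A} stands for v_0 + u v_1 + ... + u^(m-1) v_(m-1)
   and, for k < m, [mono m k x] for u^k x. *)
Definition mono (A : nzRingType) (m k : nat) (x : A) : {ffun 'I_m -> A} :=
  [ffun i : 'I_m => if i == k :> nat then x else 0].

(* The biadditive product with
     (u^i x)(u^j y) = u^(i+j) theta^j(x) y          if i + j < m,
                      u^(i+j-m) theta^j(x) y a      otherwise. *)
Definition twist_mul (A : nzRingType) (theta : A -> A) (a : A) (m : nat)
    (v w : {ffun 'I_m -> A}) : {ffun 'I_m -> A} :=
  \sum_(i < m) \sum_(j < m)
    if (i + j < m)%N then mono m (i + j) (iter j theta (v i) * w j)
    else mono m (i + j - m) (iter j theta (v i) * w j * a).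

Section TwistMul.
Variables (A : nzRingType) (theta : {rmorphism A -> A}) (a : A) (m : nat).
Implicit Types (x y : A) (v w : {ffun 'I_m -> A}).
Local Notation mono := (@mono A m).
Local Notation "v ** w" := (twist_mul theta a v w) (at level 40).

Lemma iter_rmorph0 k : iter k theta 0 = 0.
Proof. by elim: k => //= k ->; rewrite rmorph0. Qed.
Lemma iter_rmorph1 k : iter k theta 1 = 1.
Proof. by elim: k => //= k ->; rewrite rmorph1. Qed.
Lemma iter_rmorphD k : {morph iter k theta : x y / x + y}.
Proof. by move=> x y; elim: k => //= k ->; rewrite rmorphD. Qed.
Lemma iter_rmorphM k : {morph iter k theta : x y / x * y}.
Proof. by move=> x y; elim: k => //= k ->; rewrite rmorphM. Qed.

Lemma mono0 k : mono k 0 = 0.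
Proof. by apply/ffunP => i; rewrite !ffunE; case: eqP. Qed.

Lemma monoD k : {morph mono k : x y / x + y}.
Proof. by move=> x y; apply/ffunP => i; rewrite !ffunE; case: eqP; rewrite ?addr0. Qed.

Lemma mono_sum v : v = \sum_(i < m) mono i (v i).
Proof.
apply/ffunP => i; rewrite sum_ffunE (bigD1 i) //= ffunE eqxx big1 ?addr0 // => j.
by rewrite ffunE eq_sym => /negbTE; rewrite -val_eqE /= => ->.
Qed.

Lemma twist_mulDl : left_distributive (twist_mul theta a (m:=m)) +%R.
Proof.
move=> u v w; rewrite -big_split; apply: eq_bigr => i _; rewrite -big_split /=.
apply: eq_bigr => j _.
by rewrite ffunE iter_rmorphD; case: ifP => _; rewrite !mulrDl monoD.
Qed.

Lemma twist_mulDr : right_distributive (twist_mul theta a (m:=m)) +%R.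
Proof.
move=> u v w; rewrite -big_split; apply: eq_bigr => i _; rewrite -big_split /=.
apply: eq_bigr => j _.
by rewrite ffunE; case: ifP => _; rewrite ?(mulrDl, mulrDr) monoD.
Qed.

Lemma twist_mul0l w : 0 ** w = 0.
Proof. by apply: (addrI (0 ** w)); rewrite -twist_mulDl !addr0. Qed.
Lemma twist_mul0r w : w ** 0 = 0.
Proof. by apply: (addrI (w ** 0)); rewrite -twist_mulDr !addr0. Qed.

Lemma twist_mul_suml I (r : seq I) (P : pred I) (f : I -> {ffun 'I_m -> A}) w :
  (\sum_(i <- r | P i) f i) ** w = \sum_(i <- r | P i) f i ** w.
Proof.
by apply: (big_morph (fun v => v ** w)) => [x y|]; rewrite ?twist_mul0l ?twist_mulDl.
Qed.

Lemma twist_mul_sumr I (r : seq I) (P : pred I) (f : I -> {ffun 'I_m -> A}) w :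
  w ** (\sum_(i <- r | P i) f i) = \sum_(i <- r | P i) w ** f i.
Proof.
by apply: (big_morph (fun v => w ** v)) => [x y|]; rewrite ?twist_mul0r ?twist_mulDr.
Qed.

Lemma twist_mul_mono i j x y : (i < m)%N -> (j < m)%N ->
  mono i x ** mono j y =
    if (i + j < m)%N then mono (i + j) (iter j theta x * y)
    else mono (i + j - m) (iter j theta x * y * a).
Proof.
move=> im jm; rewrite /twist_mul (bigD1 (Ordinal im)) //= (bigD1 (Ordinal jm)) //=.
rewrite !ffunE !eqxx !big1 ?addr0 // => [i' ii'|j' jj'].
  apply: big1 => j' _; rewrite ffunE.
  move: ii'; rewrite -val_eqE /= => /negbTE ->.
  by rewrite iter_rmorph0 !mul0r !mono0 if_same.
rewrite [mono j y _]ffunE; move: jj'; rewrite -val_eqE /= => /negbTE ->.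
by rewrite mulr0 mul0r !mono0 if_same.
Qed.

End TwistMul.

(* (K/F, sigma, c) = K + eK + ... + e^(n-1)K.  From x e = e sigma(x) one gets
   (e^i x)(e^j y) = e^(i+j) sigma^j(x) y, and e^n = c turns this into
   [twist_mul sigma c].  The ring structure on this type depends on hF and cF,
   which are therefore parameters of it; [cyc_gen_exp], [cyc_const_gen] and
   [cyc_decomp] recover the usual presentation. *)
Definition cyclic_algebra (K : fieldType) (F : divringClosed K) (n : nat)
    (sigma : {rmorphism K -> K}) (hF : cyclic_galois F n sigma)
    (c : K) (cF : c \in F) : Type := {ffun 'I_n -> K}.

Section CyclicAlgebra.
Variables (K : fieldType) (F : divringClosed K) (n : nat).
Variables (sigma : {rmorphism K -> K}) (hF : cyclic_galois F n sigma).
Variables (c : K) (cF : c \in F).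
Local Notation D := (cyclic_algebra hF cF).

HB.instance Definition _ := GRing.Zmodule.copy D {ffun 'I_n -> K}.

Definition cyc_mul (x y : D) : D := twist_mul sigma c x y.
Definition cyc_const (l : K) : D := mono n 0 l.

(* e^k l, for all k : nat *)
Definition cyc_mono (k : nat) (l : K) : D :=
  mono n (k %% n) (l * c ^+ (k %/ n)).

Let n0 := cyclic_galois_gt0 hF.

Lemma iter_sigma_modn k l : iter (k %% n) sigma l = iter k sigma l.
Proof.
rewrite {2}(divn_eq k n) addnC iterD; congr iter.
elim: (k %/ n)%N => // q IHq.
by rewrite mulSn addnC iterD (cyclic_galois_iter hF) -IHq.
Qed.

Lemma iter_sigma_c k i : iter k sigma (c ^+ i) = c ^+ i.
Proof. by elim: k => //= k ->; rewrite rmorphXn /= (cyclic_galois_fix hF cF). Qed.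

Lemma cyc_mono_ord k l : (k < n)%N -> cyc_mono k l = mono n k l.
Proof. by move=> kn; rewrite /cyc_mono modn_small // divn_small // mulr1. Qed.

Lemma cyc_mono_addn k l : cyc_mono (k + n) l = cyc_mono k (l * c).
Proof. by rewrite /cyc_mono modnDr divnDr // divnn n0 addn1 exprS mulrA. Qed.

Lemma cyc_mulE i j x y :
  cyc_mul (cyc_mono i x) (cyc_mono j y) = cyc_mono (i + j) (iter j sigma x * y).
Proof.
rewrite /cyc_mul twist_mul_mono ?ltn_pmod // iter_sigma_modn.
rewrite iter_rmorphM iter_sigma_c /cyc_mono.
have e z : z * c ^+ (i %/ n) * (y * c ^+ (j %/ n))
    = z * y * c ^+ (i %/ n + j %/ n).
  by rewrite exprD -!mulrA; congr (_ * _); rewrite mulrCA.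
have ij : (i + j = (i %/ n + j %/ n) * n + (i %% n + j %% n))%N.
  by rewrite {1}(divn_eq i n) {1}(divn_eq j n) addnACA -mulnDl.
rewrite e ij modnMDl divnMDl //.
have : (i %% n + j %% n < n + n)%N.
  by rewrite -addSn leq_add ?ltn_pmod // ltnW ?ltn_pmod.
move: (i %% n + j %% n)%N (i %/ n + j %/ n)%N => r q.
case: (ltnP r n) => [rn _|nr r2n]; first by rewrite modn_small ?divn_small ?addn0.
have rn : (r - n < n)%N by rewrite ltn_subLR.
rewrite -{2 3}(subnK nr) modnDr divnDr // divnn n0.
by rewrite modn_small // divn_small // add0n addn1 exprSr !mulrA.
Qed.

Lemma cyc_sum (x : D) : x = \sum_(i < n) cyc_mono i (x i).
Proof. by rewrite {1}[x]mono_sum; apply: eq_bigr => i _; rewrite cyc_mono_ord. Qed.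

Lemma cyc_monoD k : {morph cyc_mono k : x y / x + y}.
Proof. by move=> x y; rewrite /cyc_mono mulrDl monoD. Qed.

Lemma cyc_ind (P : D -> Prop) :
  P 0 -> (forall x y, P x -> P y -> P (x + y)) ->
  (forall k l, P (cyc_mono k l)) -> forall x, P x.
Proof. by move=> P0 PD Pm x; rewrite [x]cyc_sum; apply: big_ind. Qed.

Lemma cyc_mulDl : left_distributive cyc_mul +%R.
Proof. exact: twist_mulDl. Qed.
Lemma cyc_mulDr : right_distributive cyc_mul +%R.
Proof. exact: twist_mulDr. Qed.
Lemma cyc_mul0r (x : D) : cyc_mul 0 x = 0.
Proof. exact: twist_mul0l. Qed.
Lemma cyc_mulr0 (x : D) : cyc_mul x 0 = 0.
Proof. exact: twist_mul0r. Qed.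

Lemma cyc_mulA : associative cyc_mul.
Proof.
move=> x y z.
elim/cyc_ind: x => [|x x' IHx IHx'|i x].
- by rewrite !cyc_mul0r.
- by rewrite !cyc_mulDl IHx IHx'.
elim/cyc_ind: y => [|y y' IHy IHy'|j y].
- by rewrite !(cyc_mul0r, cyc_mulr0).
- by rewrite !(cyc_mulDl, cyc_mulDr) IHy IHy'.
elim/cyc_ind: z => [|z z' IHz IHz'|k z].
- by rewrite !cyc_mulr0.
- by rewrite !cyc_mulDr IHz IHz'.
by rewrite !cyc_mulE addnA iter_rmorphM mulrA (addnC j k) iterD.
Qed.

Lemma cyc_constE l : cyc_const l = cyc_mono 0 l.
Proof. by rewrite cyc_mono_ord. Qed.

Lemma cyc_mul1r : left_id (cyc_const 1) cyc_mul.
Proof.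
move=> x; rewrite cyc_constE; elim/cyc_ind: x => [|x y IHx IHy|k x].
- exact: cyc_mulr0.
- by rewrite cyc_mulDr IHx IHy.
by rewrite cyc_mulE iter_rmorph1 mul1r.
Qed.

Lemma cyc_mulr1 : right_id (cyc_const 1) cyc_mul.
Proof.
move=> x; rewrite cyc_constE; elim/cyc_ind: x => [|x y IHx IHy|k x].
- exact: cyc_mul0r.
- by rewrite cyc_mulDl IHx IHy.
by rewrite cyc_mulE addn0 mulr1.
Qed.

Lemma cyc_one_neq0 : cyc_const 1 != 0.
Proof.
apply/eqP => /ffunP /(_ (Ordinal n0)); rewrite !ffunE /=.
by apply/eqP; rewrite oner_neq0.
Qed.

HB.instance Definition _ := GRing.Zmodule_isNzRing.Build D
  cyc_mulA cyc_mul1r cyc_mulr1 cyc_mulDl cyc_mulDr cyc_one_neq0.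

Definition cyc_gen : D := cyc_mono 1 1.

Lemma cyc_monoE k l : cyc_mono k l = cyc_gen ^+ k * cyc_const l.
Proof.
have -> : cyc_gen ^+ k = cyc_mono k 1.
  elim: k => [|k IHk]; first by rewrite -cyc_constE.
  by rewrite exprS IHk [LHS]cyc_mulE iter_rmorph1 mulr1.
by rewrite cyc_constE [RHS]cyc_mulE addn0 mul1r.
Qed.

Lemma cyc_gen_exp : cyc_gen ^+ n = cyc_const c.
Proof.
rewrite -[LHS]mulr1 -[1]/(cyc_const 1) -cyc_monoE cyc_constE.
by rewrite -[in LHS](add0n n) cyc_mono_addn mul1r.
Qed.

Lemma cyc_const_gen l : cyc_const l * cyc_gen = cyc_gen * cyc_const (sigma l).
Proof.
by rewrite !cyc_constE [LHS]cyc_mulE [RHS]cyc_mulE add0n addn0 mulr1 mul1r.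
Qed.

Lemma cyc_decomp (x : D) : x = \sum_(i < n) cyc_gen ^+ i * cyc_const (x i).
Proof. by rewrite {1}[x]cyc_sum; apply: eq_bigr => i _; rewrite cyc_monoE. Qed.

Lemma cyc_const_is_zmod : zmod_morphism cyc_const.
Proof.
by move=> x y; apply/ffunP => i; rewrite !ffunE; case: eqP; rewrite ?subr0.
Qed.
HB.instance Definition _ := GRing.isZmodMorphism.Build K D cyc_const
  cyc_const_is_zmod.

Lemma cyc_const_is_monoid : monoid_morphism cyc_const.
Proof. by split=> // x y; rewrite !cyc_constE [RHS]cyc_mulE. Qed.
HB.instance Definition _ := GRing.isMonoidMorphism.Build K D cyc_const
  cyc_const_is_monoid.

End CyclicAlgebra.

Section TauTilde.
Variables (K : fieldType) (F L : divringClosed K) (n m : nat).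
Variables (sigma tau : {rmorphism K -> K}).
Variables (hF : cyclic_galois F n sigma) (hL : cyclic_galois L m tau).
Hypothesis st : forall x, sigma (tau x) = tau (sigma x).
Variables (c : K) (cF : c \in F) (cL : c \in L).
Local Notation D := (cyclic_algebra hF cF).

(* The proof arguments only serve to make this map canonically a ring
   morphism. *)
Definition tau_tilde of cyclic_galois L m tau
    & (forall x, sigma (tau x) = tau (sigma x)) & c \in L :=
  fun x : D => [ffun i => tau (x i)] : D.
Local Notation tt := (tau_tilde hL st cL).

Lemma tau_tilde_is_zmod : zmod_morphism tt.
Proof. by move=> x y; apply/ffunP => i; rewrite !ffunE rmorphB. Qed.
HB.instance Definition _ := GRing.isZmodMorphism.Build D D tt tau_tilde_is_zmod.

Lemma tau_tilde_mono k l : tt (cyc_mono hF cF k l) = cyc_mono hF cF k (tau l).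
Proof.
apply/ffunP => i; rewrite !ffunE; case: eqP; rewrite ?rmorph0 //.
by rewrite rmorphM rmorphXn /= (cyclic_galois_fix hL cL).
Qed.

Lemma tau_tilde_is_monoid : monoid_morphism tt.
Proof.
split=> [|x y]; first by rewrite -[1]/(cyc_const hF cF 1) cyc_constE tau_tilde_mono rmorph1.
elim/cyc_ind: x => [|x x' IHx IHx'|i x].
- by rewrite raddf0 !mul0r raddf0.
- by rewrite mulrDl !raddfD /= mulrDl IHx IHx'.
elim/cyc_ind: y => [|y y' IHy IHy'|j y].
- by rewrite raddf0 !mulr0 raddf0.
- by rewrite mulrDr !raddfD /= mulrDr IHy IHy'.
rewrite !tau_tilde_mono [_ * _ in LHS]cyc_mulE [RHS]cyc_mulE tau_tilde_mono rmorphM.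
by congr (cyc_mono _ _ _ (_ * _)); elim: j => //= j <-.
Qed.
HB.instance Definition _ := GRing.isMonoidMorphism.Build D D tt
  tau_tilde_is_monoid.

Lemma tau_tilde_bij : bijective tt.
Proof.
have [t tK Kt] := cyclic_galois_bij hL.
exists (fun x : D => [ffun i => t (x i)] : D) => x; apply/ffunP => i.
  by rewrite !ffunE tK.
by rewrite !ffunE Kt.
Qed.

End TauTilde.

Section RingInverse.
Variables (R : nzRingType) (f : {rmorphism R -> R}) (bf : bijective f).

Lemma ring_inv_ex y : exists x, f x == y.
Proof. by have [g _ gK] := bf; exists (g y); rewrite gK. Qed.
Definition ring_inv (y : R) : R := xchoose (ring_inv_ex y).

Lemma ring_invK : cancel ring_inv f.
Proof. by move=> y; apply/eqP/(xchooseP (ring_inv_ex y)). Qed.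
Lemma ring_invKV : cancel f ring_inv.
Proof. by move=> x; apply: (bij_inj bf); rewrite ring_invK. Qed.

HB.instance Definition _ := GRing.isZmodMorphism.Build R R ring_inv
  (can2_zmod_morphism ring_invKV ring_invK).
HB.instance Definition _ := GRing.isMonoidMorphism.Build R R ring_inv
  (can2_monoid_morphism ring_invKV ring_invK).

End RingInverse.

(* D[t; rho], where t a = rho(a) t; coefficients are on the left of the powers
   of t.  Only the additive group is that of {poly D}. *)
Definition skew_poly (D : nzRingType) (rho : {rmorphism D -> D}) : Type :=
  {poly D}.

Section SkewPoly.
Variables (D : nzRingType) (rho : {rmorphism D -> D}).
Local Notation R := (skew_poly rho).

HB.instance Definition _ := GRing.Zmodule.copy R {poly D}.

Definition skew_mul (p q : R) : R :=
  \sum_(i < size (p : {poly D})) \sum_(j < size (q : {poly D}))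
     ((p : {poly D})`_i * iter i rho (q : {poly D})`_j) *: 'X^(i + j).

Definition skew_const (a : D) : R := a%:P.
Definition skew_var : R := 'X.

(* Left multiplication by t *)
Let T (q : {poly D}) : {poly D} := map_poly rho q * 'X.
Let act (p q : {poly D}) : {poly D} := \sum_(i < size p) p`_i *: iter i T q.

Let TD : {morph T : p q / p + q}.
Proof. by move=> p q; rewrite /T rmorphD mulrDl. Qed.
Let T0 : T 0 = 0.
Proof. by rewrite /T rmorph0 mul0r. Qed.
Let TZ a p : T (a *: p) = rho a *: T p.
Proof. by rewrite /T map_polyZ /= scalerAl. Qed.
Let iterTD i : {morph iter i T : p q / p + q}.
Proof. by move=> p q; elim: i => //= i ->; rewrite TD. Qed.
Let iterT0 i : iter i T 0 = 0.
Proof. by elim: i => //= i ->. Qed.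
Let iterTZX i a j : iter i T (a *: 'X^j) = iter i rho a *: 'X^(i + j).
Proof.
elim: i => //= i ->; rewrite TZ /T map_polyXn -exprSr.
by [].
Qed.

Let actE p q : skew_mul p q = act p q.
Proof.
apply: eq_bigr => i _.
transitivity (p`_i *: iter i T (\poly_(j < size q) q`_j)); last by rewrite coefK.
rewrite poly_def.
rewrite (big_morph _ (iterTD i) (iterT0 i)) scaler_sumr.
by apply: eq_bigr => j _; rewrite iterTZX scalerA.
Qed.

Let act_widen N (p q : {poly D}) : (size p <= N)%N -> act p q = \sum_(i < N) p`_i *: iter i T q.
Proof.
move=> pN; rewrite /act (big_ord_widen N (fun i => p`_i *: iter i T q)) //.
rewrite big_mkcond; apply: eq_bigr => i _; case: ltnP => // le.
by rewrite nth_default ?scale0r.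
Qed.

Let actDl : left_distributive act +%R.
Proof.
move=> p q r; pose N := maxn (size p) (size q).
rewrite !(@act_widen N) ?leq_maxl ?leq_maxr ?size_polyD // -big_split.
by apply: eq_bigr => i _; rewrite coefD scalerDl.
Qed.

Let actDr : right_distributive act +%R.
Proof.
move=> p q r; rewrite /act -big_split; apply: eq_bigr => i _.
by rewrite iterTD scalerDr.
Qed.

Let act0r q : act 0 q = 0.
Proof. by rewrite /act size_poly0 big_ord0. Qed.

Let actZl a (p q : {poly D}) : act (a *: p) q = a *: act p q.
Proof.
rewrite (@act_widen (size p)) ?size_scale_leq // scaler_sumr.
by apply: eq_bigr => i _; rewrite coefZ scalerA.
Qed.

Let actTl (p q : {poly D}) : act (T p) q = T (act p q).
Proof.
rewrite (@act_widen (size p).+1); last first.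
  rewrite /T; apply: leq_trans (size_polyMleq _ _) _.
  by rewrite size_polyX addn2 /= ltnS size_poly.
rewrite big_ord_recl coefMX eqxx scale0r add0r.
rewrite (big_morph _ TD T0); apply: eq_bigr => i _.
by rewrite coefMX /= coef_map TZ.
Qed.

Let act_iterTl i p q : act (iter i T p) q = iter i T (act p q).
Proof. by elim: i => //= i IHi; rewrite actTl IHi. Qed.

Lemma skew_mulA : associative skew_mul.
Proof.
move=> p q r; rewrite !actE {2}/act.
rewrite (big_morph (fun p => act p r) (fun x y => actDl x y r) (act0r r)).
by apply: eq_bigr => i _; rewrite actZl act_iterTl.
Qed.

Lemma skew_mul1r : left_id (skew_const 1) skew_mul.
Proof. by move=> p; rewrite actE /act size_polyC oner_neq0 big_ord1 coefC scale1r. Qed.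

Lemma skew_mulr1 : right_id (skew_const 1) skew_mul.
Proof.
move=> p; rewrite actE -[RHS]coefK poly_def; apply: eq_bigr => i _; congr (_ *: _).
by have := iterTZX i 1 0; rewrite scale1r expr0 addn0 iter_rmorph1 scale1r.
Qed.

Lemma skew_mulDl : left_distributive skew_mul +%R.
Proof. by move=> p q r; rewrite !actE actDl. Qed.
Lemma skew_mulDr : right_distributive skew_mul +%R.
Proof. by move=> p q r; rewrite !actE actDr. Qed.
Lemma skew_one_neq0 : skew_const 1 != 0.
Proof. by rewrite polyC_eq0 oner_neq0. Qed.

HB.instance Definition _ := GRing.Zmodule_isNzRing.Build R
  skew_mulA skew_mul1r skew_mulr1 skew_mulDl skew_mulDr skew_one_neq0.

Lemma skew_var_const a :
  skew_var * skew_const a = skew_const (rho a) * skew_var.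
Proof.
rewrite [LHS]actE [RHS]actE /act size_polyX size_polyC !big_ord_recl big_ord0.
rewrite !coefX !eqxx scale0r add0r addr0 scale1r /= /T map_polyC /=.
case: eqP => [->|_]; first by rewrite !big_ord0 /= ?rmorph0 mul0r.
by rewrite big_ord1 coefC /= mul_polyC.
Qed.

Lemma skew_varX i : skew_var ^+ i = 'X^i :> {poly D}.
Proof.
elim: i => // i IHi; rewrite exprS [LHS]actE IHi /act size_polyX.
by rewrite !big_ord_recl big_ord0 !coefX scale0r add0r addr0 scale1r /= /T map_polyXn -exprSr.
Qed.

Lemma skew_constM a (p : R) : skew_const a * p = a *: (p : {poly D}) :> {poly D}.
Proof.
rewrite [LHS]actE /act size_polyC; case: eqP => [->|_].
  by rewrite big_ord0 scale0r.
by rewrite big_ord1 coefC.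
Qed.

Lemma skew_polyE (p : R) :
  p = \sum_(i < size (p : {poly D})) skew_const (p : {poly D})`_i * skew_var ^+ i.
Proof.
rewrite -{1}[p]coefK poly_def; apply: eq_bigr => i _.
by rewrite skew_constM skew_varX.
Qed.

Lemma skew_const_is_zmod : zmod_morphism skew_const.
Proof. by move=> x y; rewrite /skew_const polyCB. Qed.
HB.instance Definition _ := GRing.isZmodMorphism.Build D R skew_const
  skew_const_is_zmod.
Lemma skew_const_is_monoid : monoid_morphism skew_const.
Proof.
by split=> // x y; rewrite [RHS]skew_constM /skew_const -mul_polyC polyCM.
Qed.
HB.instance Definition _ := GRing.isMonoidMorphism.Build D R skew_const
  skew_const_is_monoid.

End SkewPoly.

Section RightDivision.
Variables (D : nzRingType) (rho : {rmorphism D -> D}).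
Local Notation R := (skew_poly rho).
Local Notation T := (skew_var rho).
Local Notation "p ``_ i" := ((p : {poly D})`_i) (at level 3, i at level 2).
Local Notation sz p := (size (p : {poly D})).

(* deg g < deg f; for f = 0 this forces g = 0. *)
Definition deg_lt (f : R) : pred R := fun g => (sz g <= (sz f).-1)%N.

(* g mod_r f; [right_div_ex] and [right_div_uniq] give existence and uniqueness
   when the leading coefficient of f is invertible. *)
Definition right_mod (g f : R) : R :=
  xget 0 [set r : R | deg_lt f r /\ exists q : R, g = q * f + r].

Lemma coef_skew_varXM k (p : R) i :
  (T ^+ k * p)``_i = if (i < k)%N then 0 else iter k rho p``_(i - k).
Proof.
elim: k i => [|k IHk] i; first by rewrite expr0 mul1r subn0.
have tE (q : R) j : (T * q)``_j = if j is j'.+1 then rho q``_j' else 0.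
  rewrite {1}[q]skew_polyE mulr_sumr coef_sum.
  rewrite (eq_bigr (fun l : 'I_(sz q) => rho q``_l * (j == l.+1)%:R)); last first.
    move=> l _; rewrite mulrA skew_var_const -mulrA -exprS.
    by rewrite skew_constM skew_varX coefZ coefXn.
  case: j => [|j]; first by rewrite big1 // => l _; rewrite mulr0.
  case: (ltnP j (sz q)) => [jq|qj].
    rewrite (bigD1 (Ordinal jq)) //= eqxx mulr1 big1 ?addr0 // => l.
    by rewrite -val_eqE eqSS eq_sym /= => /negbTE->; rewrite mulr0.
  rewrite nth_default // rmorph0 big1 // => l _.
  by rewrite eqSS gtn_eqF ?mulr0 // (leq_trans _ qj).
rewrite exprS -mulrA tE; case: i => // i.
by rewrite IHk ltnS subSS; case: ltnP => // _; rewrite rmorph0.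
Qed.

Lemma right_div_ex (f g : R) : invertible (lead_coef (f : {poly D})) ->
  exists r, deg_lt f r /\ exists q, g = q * f + r.
Proof.
move=> [b [bl lb]]; have [N] := ubnP (sz g); elim: N g => // N IHN g.
rewrite ltnS => gN; case: (leqP (sz g) (sz f).-1) => [gf|fg].
  by exists g; split=> //; exists 0; rewrite mul0r add0r.
pose k := ((sz g).-1 - (sz f).-1)%N.
have kE : (k + (sz f).-1 = (sz g).-1)%N by rewrite subnK // -ltnS (ltn_predK fg).
pose h : R := skew_const rho (g``_(sz g).-1 * iter k rho b) * T ^+ k.
have hf i : (h * f)``_i = g``_(sz g).-1 * iter k rho b *
    (if (i < k)%N then 0 else iter k rho f``_(i - k)).
  by rewrite /h -mulrA skew_constM coefZ coef_skew_varXM.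
have lt : (sz (g - h * f)%R < N)%N.
  apply: leq_trans gN; rewrite -(ltn_predK fg) ltnS; apply/leq_sizeP => j.
  rewrite leq_eqVlt coefB hf => /predU1P[<-|gj].
    rewrite -{3 4}kE ltnNge leq_addr /= addKn -mulrA -iter_rmorphM bl.
    by rewrite iter_rmorph1 mulr1 subrr.
  rewrite nth_default; last by rewrite -(ltn_predK fg).
  rewrite sub0r; case: ltnP => kj; first by rewrite mulr0 oppr0.
  rewrite [f``_(_)]nth_default ?iter_rmorph0 ?mulr0 ?oppr0 //.
  apply: (leq_trans (leqSpred _)).
  by rewrite ltn_subRL kE.
have [r [rf [q qE]]] := IHN _ lt.
exists r; split=> //; exists (h + q).
by rewrite mulrDl -addrA -qE addrC subrK.
Qed.

Lemma right_div_uniq (f q q' r r' : R) : invertible (lead_coef (f : {poly D})) ->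
  deg_lt f r -> deg_lt f r' -> q * f + r = q' * f + r' -> q = q' /\ r = r'.
Proof.
move=> [b [bl lb]] rf r'f e.
suff qq : q - q' = 0.
  by move: e; rewrite -(subrK q' q) qq add0r => /addrI.
have {}e : (q - q') * f = r' - r.
  by rewrite mulrBl; apply/eqP; rewrite subr_eq addrAC eq_sym subr_eq eq_sym addrC e addrC.
have {}rf : deg_lt f (r' - r).
  apply: leq_trans (size_polyD _ _) _.
  by rewrite size_polyN geq_max; apply/andP; split.
move: (q - q') (r' - r) rf e => {}q {}r rf e.
apply/eqP; apply: contraT => q0.
have sq : (0 < sz q)%N by rewrite size_poly_gt0.
have : r``_((sz q).-1 + (sz f).-1) = 0.
  by rewrite nth_default // (leq_trans rf) // leq_addl.
rewrite -e {1}[q]skew_polyE mulr_suml coef_sum.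
have sq1 : ((sz q).-1 < sz q)%N by rewrite prednK.
rewrite (bigD1 (Ordinal sq1)) //= big1 => [|i]; last first.
  rewrite -val_eqE /= => iq.
  rewrite -mulrA skew_constM coefZ coef_skew_varXM.
  have {}iq : (i < (sz q).-1)%N by rewrite ltn_neqAle iq -ltnS prednK // ltn_ord.
  case: ltnP => // _; first by rewrite mulr0.
  rewrite [f``_(_)]nth_default ?iter_rmorph0 ?mulr0 //.
  apply: (leq_trans (leqSpred _)).
  by rewrite ltn_subRL ltn_add2r.
rewrite addr0 -mulrA skew_constM coefZ coef_skew_varXM ltnNge leq_addr /= addKn.
move/(congr1 (fun x => x * iter (sz q).-1 rho b)).
rewrite -mulrA -iter_rmorphM lb iter_rmorph1 mulr1 mul0r => /eqP.
by rewrite (lead_coef_eq0 (q : {poly D})) (negbTE q0).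
Qed.

Lemma right_mod_lt g f : deg_lt f (right_mod g f).
Proof. by rewrite /right_mod; case: xgetP => [r _ []|_] //; rewrite /deg_lt size_poly0. Qed.

Lemma right_modP (g f : R) : invertible (lead_coef (f : {poly D})) ->
  exists q, g = q * f + right_mod g f.
Proof. by move=> lf; have [] := xgetPex 0 (right_div_ex g lf). Qed.

Lemma right_mod_eq (g f q r : R) : invertible (lead_coef (f : {poly D})) ->
  deg_lt f r -> g = q * f + r -> right_mod g f = r.
Proof.
move=> lf rf gE; have [q' gE'] := right_modP g lf.
suff e : q' * f + right_mod g f = q * f + r.
  by have [] := right_div_uniq lf (right_mod_lt g f) rf e.
by rewrite -gE' gE.
Qed.

End RightDivision.

(* S_f, the g with deg g < deg f.  It need not be associative, so its product
   [petit_mul] does not come with a ring structure. *)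
Record petit_algebra (D : nzRingType) (rho : {rmorphism D -> D})
    (f : skew_poly rho) : Type :=
  PetitAlgebra { petit_val : skew_poly rho; _ : petit_val \in deg_lt f }.

Section PetitAlgebra.
Variables (D : nzRingType) (rho : {rmorphism D -> D}) (f : skew_poly rho).

Lemma deg_lt_zmod_closed : zmod_closed (deg_lt f).
Proof.
split=> [|p q]; rewrite !unfold_in /deg_lt ?size_poly0 // => pf qf.
by apply: leq_trans (size_polyD _ _) _; rewrite size_polyN geq_max; apply/andP; split.
Qed.
HB.instance Definition _ := GRing.isZmodClosed.Build (skew_poly rho) (deg_lt f)
  deg_lt_zmod_closed.

HB.instance Definition _ := [isSub for @petit_val D rho f].
HB.instance Definition _ := [Choice of petit_algebra f by <:].
HB.instance Definition _ :=
  [SubChoice_isSubZmodule of petit_algebra f by <:].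

Definition petit_mul (g h : petit_algebra f) : petit_algebra f :=
  PetitAlgebra (right_mod_lt (val g * val h) f).

End PetitAlgebra.

(* It^m(D, theta, d), a right D-module by [it_scale]; it need not be associative
   either. *)
Definition iterated_algebra (D : nzRingType) (theta : {rmorphism D -> D})
    (m : nat) (d : D) : Type := {ffun 'I_m -> D}.

Section IteratedAlgebra.
Variables (D : nzRingType) (theta : {rmorphism D -> D}) (m : nat) (d : D).
Local Notation It := (iterated_algebra theta m d).

HB.instance Definition _ := GRing.Zmodule.copy It {ffun 'I_m -> D}.

Definition it_mul (v w : It) : It := twist_mul theta d v w.
Definition it_one : It := mono m 0 1.
Definition it_scale (v : It) (x : D) : It := [ffun i => v i * x].

End IteratedAlgebra.

(* Main.v *)
Require Import Defs.
From mathcomp Require Import all_boot all_algebra.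

Import GRing.Theory.
Local Open Scope ring_scope.

(** Write [theta] for the automorphism twisting the iterated algebra and [rho]
    for its inverse.  In [D[t; rho]] the rule [t a = rho(a) t] reads
    [a t = t theta(a)], so constants move to the right of powers of [t] by
    [theta], and [(t^i x)(t^j y) = t^(i+j) theta^j(x) y] holds exactly as in
    the iterated algebra.  A power [t^(k+m)] is reduced modulo [f = t^m - d] by
    [t^(k+m) z = (t^k z) t^m = (t^k z) f + t^k z d]; the first equality says
    that [z] commutes with [t^m], which holds because [theta^m = id].  So the
    remainder is the wrapped-around product [u^k z d] (lemma
    [skew_of_mul_mod]).

    That [sum t^i v_i] parametrises the polynomials of degree less than [m] is
    the passage from right to left coefficients: its coefficients are the
    [rho^i(v_i)] (lemma [coef_skew_of]), and [rho] is bijective.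

    This applies to every ring [D] with an automorphism of exponent [m].  For
    the cyclic algebra, [theta^m = id] comes from [tau^m = id], and linearity
    over the intersection of [F] and [L] holds because elements of [F] are
    central in [D] while those of [L] are fixed by [theta], so that the latter
    commute with [t]. *)

Lemma iter_cancel (A : Type) (g h : A -> A) k :
  cancel g h -> cancel (iter k g) (iter k h).
Proof. by move=> gK x; elim: k => // k IHk; rewrite iterSr iterS gK. Qed.

Section SkewPolyQuotient.
Variables (D : nzRingType) (theta rho : {rmorphism D -> D}).
Hypotheses (thetaK : cancel theta rho) (rhoK : cancel rho theta).
Local Notation R := (skew_poly rho).
Local Notation T := (skew_var rho).
Local Notation C := (skew_const rho).
Local Notation "p ``_ i" := ((p : {poly D})`_i) (at level 3, i at level 2).

Lemma skew_const_varX k a : C a * T ^+ k = T ^+ k * C (iter k theta a).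
Proof.
elim: k => [|k IHk]; first by rewrite expr0 mulr1 mul1r.
rewrite exprSr mulrA IHk -!mulrA; congr (_ * _).
by rewrite skew_var_const /= thetaK.
Qed.

Lemma skew_monomialM i j x y :
  (T ^+ i * C x) * (T ^+ j * C y) = T ^+ (i + j) * C (iter j theta x * y).
Proof. by rewrite rmorphM exprD !mulrA -(mulrA _ (C x)) skew_const_varX !mulrA. Qed.

Lemma coef_skew_varX_const k x i :
  (T ^+ k * C x)``_i = if i == k then iter k rho x else 0.
Proof.
rewrite coef_skew_varXM coefC subn_eq0; case: ltngtP => // _.
by rewrite iter_rmorph0.
Qed.

(** Coefficients stand to the right of the powers of [t], as they do in the
    iterated algebra; the coefficients of a twisted polynomial stand to the
    left. *)
Definition skew_of (m : nat) (v : {ffun 'I_m -> D}) : R :=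
  \sum_(i < m) T ^+ i * C (v i).

Lemma coef_skew_of m (v : {ffun 'I_m -> D}) (i : 'I_m) :
  (skew_of m v)``_i = iter i rho (v i).
Proof.
rewrite coef_sum (bigD1 i) //= coef_skew_varX_const eqxx big1 ?addr0 // => j.
by rewrite coef_skew_varX_const -val_eqE eq_sym => /negbTE ->.
Qed.

Lemma size_skew_of m (v : {ffun 'I_m -> D}) :
  (size (skew_of m v : {poly D}) <= m)%N.
Proof.
apply/leq_sizeP => j mj; rewrite coef_sum big1 // => i _.
by rewrite coef_skew_varX_const gtn_eqF // (leq_trans _ mj).
Qed.

Lemma skew_ofD m : {morph skew_of m : v w / v + w}.
Proof.
move=> v w; rewrite -big_split; apply: eq_bigr => i _.
by rewrite ffunE rmorphD mulrDr.
Qed.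

Lemma skew_of0 m : skew_of m 0 = 0.
Proof. by apply: big1 => i _; rewrite ffunE rmorph0 mulr0. Qed.

Lemma skew_of_mono m k x : (k < m)%N -> skew_of m (mono m k x) = T ^+ k * C x.
Proof.
move=> km; rewrite /skew_of (bigD1 (Ordinal km)) //= ffunE eqxx big1 ?addr0 //.
by move=> i; rewrite -val_eqE ffunE => /negbTE ->; rewrite rmorph0 mulr0.
Qed.

(** A scalar that is central in [D] and fixed by [theta] is central in
    [D[t; rho]], so it can be moved from the right of [v] to the left. *)
Lemma skew_of_scale m a (v : {ffun 'I_m -> D}) :
    (forall x, a * x = x * a) -> theta a = a ->
  skew_of m [ffun i => v i * a] = C a * skew_of m v.
Proof.
move=> aC aE; rewrite mulr_sumr; apply: eq_bigr => i _.
rewrite mulrA skew_const_varX ffunE -mulrA -rmorphM /=.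
suff -> : iter i theta a = a by rewrite aC.
by elim: (i : nat) => //= k ->.
Qed.

Section Quotient.
Variables (m : nat) (d : D).
Hypothesis m_gt0 : (0 < m)%N.
Let f : R := T ^+ m - C d.

Let fE : f = 'X^m - d%:P :> {poly D}.
Proof. by rewrite /f skew_varX. Qed.

Lemma invertible_lead_coef_XnsubC : invertible (lead_coef (f : {poly D})).
Proof. by rewrite fE lead_coefXnsubC //; exists 1; rewrite mulr1. Qed.

Lemma deg_ltE (g : R) : (g \in deg_lt f) = (size (g : {poly D}) <= m)%N.
Proof. by rewrite unfold_in /deg_lt fE size_XnsubC. Qed.

Lemma skew_of_deg_lt v : skew_of m v \in deg_lt f.
Proof. by rewrite deg_ltE size_skew_of. Qed.

Definition petit_of (v : iterated_algebra theta m d) : petit_algebra f :=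
  PetitAlgebra (skew_of_deg_lt v).

Lemma petit_of_bij : bijective petit_of.
Proof.
exists (fun g => [ffun i : 'I_m => iter i theta (petit_val g)``_i]) => [v|g].
  by apply/ffunP => i; rewrite ffunE coef_skew_of (iter_cancel _ _ _ _ rhoK).
apply: val_inj; apply/polyP => i /=.
have gm : (size (petit_val g : {poly D}) <= m)%N by rewrite -deg_ltE; apply: valP.
case: (ltnP i m) => [im|mi].
  by rewrite (coef_skew_of _ _ (Ordinal im)) ffunE (iter_cancel _ _ _ _ thetaK).
by rewrite !nth_default // ?(leq_trans (size_skew_of _ _)) ?(leq_trans gm).
Qed.

Hypothesis theta_order : forall x, iter m theta x = x.

Lemma monomial_mod k z : T ^+ (k + m) * C z = T ^+ k * C z * f + T ^+ k * C (z * d).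
Proof.
by rewrite mulrBr -!mulrA -rmorphM skew_const_varX theta_order exprD mulrA subrK.
Qed.

(** The product of polynomials agrees with the twisted product up to a left
    multiple of [f].  Both products are double sums over pairs of monomials and
    the claim is additive, so a pair of monomials is enough. *)
Lemma skew_of_mul_mod v w :
  exists q, skew_of m v * skew_of m w = q * f + skew_of m (twist_mul theta d v w).
Proof.
pose modf (g : R) (u : {ffun 'I_m -> D}) := exists q, g = q * f + skew_of m u.
have mod0 : modf 0 0 by exists 0; rewrite skew_of0 mul0r addr0.
have modD g1 u1 g2 u2 : modf g1 u1 -> modf g2 u2 -> modf (g1 + g2) (u1 + u2).
  move=> [q1 ->] [q2 ->]; exists (q1 + q2).
  by rewrite skew_ofD mulrDl addrACA.
rewrite -/(modf _ _) mulr_suml; apply: (big_ind2 modf) => // i _.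
rewrite mulr_sumr; apply: (big_ind2 modf) => // j _.
rewrite skew_monomialM; case: ltnP => [ij|mij].
  by exists 0; rewrite mul0r add0r skew_of_mono.
have ij : (i + j - m < m)%N by rewrite ltn_subLR // -addSn leq_add // ltnW.
rewrite -{1}(subnK mij) monomial_mod.
by exists (T ^+ (i + j - m) * C (iter j theta (v i) * w j)); rewrite skew_of_mono.
Qed.

Lemma petit_ofM : {morph petit_of : v w / it_mul v w >-> petit_mul v w}.
Proof.
move=> v w; apply: val_inj => /=; have [q qE] := skew_of_mul_mod v w.
apply: esym (right_mod_eq invertible_lead_coef_XnsubC _ qE).
exact: skew_of_deg_lt.
Qed.

End Quotient.
End SkewPolyQuotient.

Section Cyclic.
Variables (K : fieldType) (F L : divringClosed K) (n m : nat).
Variables (sigma tau : {rmorphism K -> K}).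
Variables (hF : cyclic_galois F n sigma) (hL : cyclic_galois L m tau).
Hypothesis st : forall x, sigma (tau x) = tau (sigma x).
Variables (c : K) (cF : c \in F) (cL : c \in L).
Local Notation D := (cyclic_algebra hF cF).
Local Notation tt := (tau_tilde hL st cL : D -> D).

Lemma tau_tilde_order (x : D) : iter m tt x = x.
Proof.
have iterE k : iter k tt x = [ffun i => iter k tau (x i)].
  by elim: k => [|k IHk] /=; apply/ffunP => i; rewrite ?IHk !ffunE.
by apply/ffunP => i; rewrite iterE ffunE (cyclic_galois_iter hL).
Qed.

Lemma tau_tilde_const a : a \in L -> tt (cyc_const hF cF a) = cyc_const hF cF a.
Proof.
by move=> aL; rewrite !cyc_constE tau_tilde_mono (cyclic_galois_fix hL aL).
Qed.

Lemma cyc_const_central a (x : D) :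
  a \in F -> cyc_const hF cF a * x = x * cyc_const hF cF a.
Proof.
move=> aF; rewrite cyc_constE; elim/cyc_ind: x => [|x y IHx IHy|k l].
- by rewrite mulr0 mul0r.
- by rewrite mulrDr mulrDl IHx IHy.
rewrite [LHS]cyc_mulE [RHS]cyc_mulE addn0 mulrC; congr (cyc_mono _ _ _ (_ * _)).
by elim: k => //= k ->; rewrite (cyclic_galois_fix hF aF).
Qed.

End Cyclic.

Theorem theorem7 (K : fieldType) (F L : divringClosed K) (n m : nat)
    (sigma tau : {rmorphism K -> K})
    (hF : cyclic_galois F n sigma) (hL : cyclic_galois L m tau)
    (st : forall x : K, sigma (tau x) = tau (sigma x))
    (c : K) (cF : c \in F) (cL : c \in L) (c_neq0 : c != 0)
    (hD : division_ring (cyclic_algebra hF cF))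
    (d : cyclic_algebra hF cF) (hd : invertible d) :
  let D := cyclic_algebra hF cF in
  let tt : {rmorphism D -> D} := tau_tilde hL st cL in
  let rho : {rmorphism D -> D} := ring_inv (tau_tilde_bij hF hL st cF cL) in
  let R := skew_poly rho in
  let t : R := skew_var rho in
  let f : R := t ^+ m - skew_const rho d in
  exists phi : iterated_algebra tt m d -> petit_algebra f,
    [/\ (forall v : iterated_algebra tt m d,
           petit_val (phi v) = \sum_(i < m) t ^+ i * skew_const rho (v i)),
        bijective phi,
        {morph phi : v w / v + w},
        petit_val (phi (it_one tt m d)) = 1 :> R
      & {morph phi : v w / it_mul v w >-> petit_mul v w} /\
        (forall (a : K) (v : iterated_algebra tt m d), a \in F -> a \in L ->
           petit_val (phi (it_scale v (cyc_const hF cF a)))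
             = skew_const rho (cyc_const hF cF a) * petit_val (phi v))].
Proof.
move=> D tt rho R t f.
have ttK : cancel tt rho by apply: ring_invKV.
have rhoK : cancel rho tt by apply: ring_invK.
have m_gt0 := cyclic_galois_gt0 hL.
exists (petit_of D tt rho m d m_gt0); split=> //.
- exact: petit_of_bij.
- by move=> v w; apply: val_inj; apply: skew_ofD.
- by rewrite /= skew_of_mono // expr0 mul1r rmorph1.
split=> [|a v aF aL]; first by apply: petit_ofM => //; apply: tau_tilde_order.
apply: (skew_of_scale _ _ _ ttK) => [x|]; first exact: cyc_const_central.
exact: tau_tilde_const.
Qed.
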